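(* Let $Sp(K,S)$ be a split graph such that $|K|\ge 2$. If $\operatorname{Cker}(Sp)\ne\{0\}$, then $\operatorname{Supp}(Sp)\cap K\ne\varnothing$ if and only if $\dim(\operatorname{Cker}(Sp))=1$.
   Context: Graphs are finite and simple. A split graph is a graph $Sp$ whose vertex set is a disjoint union of a clique $K$ and an independent set $S$; the pair $(K,S)$ is called an s-partition, and $Sp(K,S)$ denotes $Sp$ together with this s-partition. Both $K$ and $S$ are assumed nonempty. With the vertices ordered as $(K,S)$, the adjacency matrix is \[A(Sp)=\begin{pmatrix} J-I & R\\ R^t & 0\end{pmatrix},\] where $J$ is an all-ones matrix, $I$ the identity, and $R$ is the $|K|\times|S|$ $0/1$ biadjacency matrix ($R_{uv}=1$ iff $u\in K$ and $v\in S$ are adjacent). $\mathcal{N}(A)$ and $\operatorname{im}(A)$ are the nullspace and column space of a real matrix $A$. $\operatorname{Supp}(Sp)$ is the set of vertices $v$ such that $x_v\ne 0$ for some $x\in\mathcal{N}(A(Sp))$. For $|K|\ge 2$ the matrix $I-J$ of order $|K|$ is invertible, and the clique-kernel is $\operatorname{Cker}(Sp)=\mathcal{N}(R^t)\cap\operatorname{im}((I-J)^{-1}R)\subseteq\mathbb{R}^{|K|}$. *)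

(* Defs.v *)
From HB Require Import structures.
From mathcomp Require Import all_boot all_order all_algebra.
From mathcomp Require Import boolp reals.

Set Implicit Arguments.
Unset Strict Implicit.
Unset Printing Implicit Defensive.

Import Order.TTheory GRing.Theory Num.Theory.
Local Open Scope ring_scope.

Definition simple_graph (T : finType) (e : rel T) : Prop :=
  symmetric e /\ irreflexive e.

Definition clique (T : finType) (e : rel T) (K : {set T}) : Prop :=
  {in K &, forall u v, u != v -> e u v}.

Definition independent (T : finType) (e : rel T) (S : {set T}) : Prop :=
  {in S &, forall u v, ~~ e u v}.

Definition s_partition (T : finType) (e : rel T) (K S : {set T}) : Prop :=
  [/\ K :|: S = [set: T], [disjoint K & S], clique e K & independent e S]
  /\ (K != set0 /\ S != set0).

Definition nullspace (R : fieldType) (m n : nat) (A : 'M[R]_(m, n)) :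
    {vspace 'cV[R]_n} :=
  lker (linfun (mulmx A : 'cV[R]_n -> 'cV[R]_m)).

Definition colspace (R : fieldType) (m n : nat) (A : 'M[R]_(m, n)) :
    {vspace 'cV[R]_m} :=
  limg (linfun (mulmx A : 'cV[R]_n -> 'cV[R]_m)).

(* The vertices listed in the order (K, S); when (K, S) is an s-partition this
   is a bijection onto T. *)
Definition ks_vertex (T : finType) (K S : {set T}) (i : 'I_(#|K| + #|S|)) : T :=
  match split i with
  | inl a => enum_val a
  | inr b => enum_val b
  end.

Definition adjmx (R : realType) (T : finType) (e : rel T) (K S : {set T}) :
    'M[R]_(#|K| + #|S|) :=
  \matrix_(i, j) (e (ks_vertex i) (ks_vertex j))%:R.

Definition biadjmx (R : realType) (T : finType) (e : rel T) (K S : {set T}) :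
    'M[R]_(#|K|, #|S|) :=
  \matrix_(i, j) (e (enum_val i) (enum_val j))%:R.

Lemma adjmx_block (R : realType) (T : finType) (e : rel T) (K S : {set T}) :
  simple_graph e -> s_partition e K S ->
  adjmx R e K S =
  block_mx (const_mx 1 - 1%:M) (biadjmx R e K S) (biadjmx R e K S)^T 0.
Proof.
move=> [esym eirr] [[_ _ clK inS] _]; apply/matrixP=> i j.
rewrite -(splitK i) -(splitK j).
case: (split i) => a; case: (split j) => b;
  rewrite /= ?block_mxEul ?block_mxEur ?block_mxEdl ?block_mxEdr;
  rewrite [LHS]mxE /ks_vertex ?(unsplitK (inl _)) ?(unsplitK (inr _)) !mxE //.
- case: (eqVneq a b) => [->|neq] /=; first by rewrite eirr mulr1n subrr.
  by rewrite mulr0n subr0 clK ?enum_valP // (inj_eq enum_val_inj).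
- by rewrite esym.
- by rewrite (negbTE (inS _ _ (enum_valP a) (enum_valP b))).
Qed.

Definition Supp (R : realType) (T : finType) (e : rel T) (K S : {set T}) :
    {set T} :=
  [set ks_vertex i | i : 'I_(#|K| + #|S|) &
     `[< exists2 x, x \in nullspace (adjmx R e K S) & x i 0 != 0 >]].

Definition Cker (R : realType) (T : finType) (e : rel T) (K S : {set T}) :
    {vspace 'cV[R]_#|K|} :=
  (nullspace (biadjmx R e K S)^T :&:
   colspace (invmx (1%:M - const_mx 1) *m biadjmx R e K S))%VS.

(* Main.v *)
(** The clique-kernel is exactly the projection to [K] of the nullspace of the
    adjacency matrix, so [Supp] meets [K] as soon as the clique-kernel is
    nonzero.  If [x] is in the clique-kernel, then [(I - J) x = R y] and
    [R^t x = 0], hence [x^t (I - J) x = 0], i.e. [|x|^2 = (\sum_i x_i)^2]: the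
    coordinate sum is an injective linear form on the clique-kernel, whose
    dimension is therefore at most 1.  Both sides of the equivalence thus hold
    whenever the clique-kernel is nonzero. *)
Require Import Defs.
From HB Require Import structures.
From mathcomp Require Import all_boot all_order all_algebra.
From mathcomp Require Import boolp reals.
From mathcomp Require Import ring.

Set Implicit Arguments.
Unset Strict Implicit.
Unset Printing Implicit Defensive.

Import Order.TTheory GRing.Theory Num.Theory.
Local Open Scope ring_scope.

Lemma mem_nullspace (F : fieldType) (m n : nat) (A : 'M[F]_(m, n))
    (x : 'cV[F]_n) :
  (x \in nullspace A) = (A *m x == 0).
Proof. by rewrite memv_ker lfunE. Qed.

Lemma mem_colspaceP (F : fieldType) (m n : nat) (A : 'M[F]_(m, n))
    (x : 'cV[F]_m) :
  reflect (exists y, x = A *m y) (x \in colspace A).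
Proof.
apply: (iffP memv_imgP) => [[y _ ->]|[y ->]]; exists y;
  by rewrite ?memvf ?lfunE.
Qed.

(** With $J$ the all-ones matrix, $J^2 = nJ$, so $I - (n-1)^{-1}J$ is an explicit inverse; $n \ge 2$
    keeps $n-1$ nonzero. *)
Lemma sub1_const_mx_unit (F : numFieldType) (n : nat) :
  (2 <= n)%N -> (1%:M - const_mx 1 : 'M[F]_n) \in unitmx.
Proof.
move=> n2; have nz : (n%:R - 1 : F) != 0.
  by rewrite subr_eq0 (eqr_nat F n 1) gtn_eqF.
pose J : 'M[F]_n := const_mx 1.
have JJ : J *m J = n%:R *: J.
  apply/matrixP=> i j; rewrite !mxE mulr1.
  by under eq_bigr do rewrite !mxE mulr1; rewrite sumr_const card_ord.
suff /mulmx1_unit[] : (1%:M - J) *m (1%:M - (n%:R - 1)^-1 *: J) = 1%:M by [].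
rewrite mulmxBl mul1mx mulmxBr mulmx1 -scalemxAr JJ.
by apply/matrixP=> i j; rewrite !mxE; field.
Qed.

(** Multiplying by $I-J$ clears the inverse in [Cker]. What remains are the two block rows of the
    adjacency system for the vector $(x,y)$. *)
Lemma mem_CkerP (R : realType) (T : finType) (e : rel T) (K S : {set T})
    (x : 'cV[R]_#|K|) :
  (2 <= #|K|)%N ->
  reflect ((biadjmx R e K S)^T *m x = 0 /\
           exists y, (1%:M - const_mx 1) *m x = biadjmx R e K S *m y)
          (x \in Cker R e K S).
Proof.
move=> hK; have U := sub1_const_mx_unit R hK.
rewrite memv_cap mem_nullspace.
apply: (iffP andP) => [[/eqP Rx /mem_colspaceP[y xE]]|[/eqP Rx [y xE]]].
  by split=> //; exists y; rewrite xE -mulmxA mulKVmx.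
by split=> //; apply/mem_colspaceP; exists y; rewrite -mulmxA -xE mulKmx.
Qed.

Lemma Cker_sum_eq0 (R : realType) (T : finType) (e : rel T) (K S : {set T})
    (x : 'cV[R]_#|K|) :
  (2 <= #|K|)%N -> x \in Cker R e K S ->
  (const_mx 1 : 'rV_#|K|) *m x = 0 -> x = 0.
Proof.
move=> hK /(mem_CkerP _ _ _ hK)[Rx [y xE]] sx0.
have Jx : const_mx 1 *m x = 0 :> 'cV_#|K|.
  apply/matrixP=> i j; move/matrixP/(_ 0 j): sx0.
  rewrite !mxE => sx; rewrite -[RHS]sx.
  by apply: eq_bigr => k _; rewrite !mxE.
have xx0 : x^T *m x = 0.
  (* Since $Jx = 0$, the second factor is $x = (I-J)x = Ry$, so $x^t x = (R^t x)^t y = 0$. *)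
  rewrite -{2}[x]subr0 -Jx -{2}[x]mul1mx -mulmxBl xE mulmxA.
  by rewrite -[x^T *m _]trmxK trmx_mul trmxK Rx trmx0 mul0mx.
(* A vanishing sum of real squares has only zero terms. *)
apply/matrixP=> i j; rewrite (ord1 j) !mxE; move/matrixP/(_ 0 0): xx0.
rewrite !mxE => /eqP; rewrite psumr_eq0 => [/allP/(_ i)|k _]; last first.
  by rewrite mxE -expr2 sqr_ge0.
by rewrite mem_index_enum mxE mulf_eq0 orbb => /(_ isT)/eqP.
Qed.

Lemma dim_Cker_le1 (R : realType) (T : finType) (e : rel T) (K S : {set T}) :
  (2 <= #|K|)%N -> (\dim (Cker R e K S) <= 1)%N.
Proof.
move=> hK.
pose f := linfun (mulmx (const_mx 1) : 'cV[R]_#|K| -> 'M[R]_1).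
have kf : (Cker R e K S :&: lker f = 0)%VS.
  apply/eqP; rewrite -subv0; apply/subvP=> x; rewrite memv_cap => /andP[xC].
  rewrite memv_ker lfunE /= => /eqP sx0; rewrite memv0.
  by rewrite (Cker_sum_eq0 hK xC sx0).
(* Rank-nullity: the kernel part is trivial and the image lies in the one-dimensional space of $1
   \times 1$ matrices. *)
rewrite -(limg_ker_dim f) kf dimv0 add0n.
by rewrite (leq_trans (dimvS (subvf _))) // dimvf /dim /= muln1.
Qed.

Lemma Supp_clique_neq0 (R : realType) (T : finType) (e : rel T)
    (K S : {set T}) :
  simple_graph e -> s_partition e K S -> (2 <= #|K|)%N ->
  Cker R e K S <> 0%VS -> Supp R e K S :&: K <> set0.
Proof.
move=> he hKS hK hC; have := memv_pick (Cker R e K S).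
have : vpick (Cker R e K S) != 0 by rewrite vpick0; apply/eqP.
move: (vpick _) => x x0 /(mem_CkerP _ _ _ hK)[Rx [y xE]].
have [i xi0] : exists i, x i 0 != 0.
  apply/existsP; apply: contraNT x0 => /existsPn xi0.
  apply/eqP/matrixP=> i j; rewrite (ord1 j) mxE.
  by apply/eqP; rewrite -[_ == _]negbK.
apply/eqP/set0Pn; exists (enum_val i); rewrite inE enum_valP andbT.
apply/imsetP; exists (lshift #|S| i); last first.
  by rewrite /ks_vertex -[lshift _ _]/(unsplit (inl i)) unsplitK.
(* The preimage $y$ supplies the entries on $S$: the upper block row becomes $-(I-J)x + Ry = 0$, the
   lower one $R^t x = 0$. *)
rewrite inE; apply/asboolP; exists (col_mx x y); last by rewrite col_mxEu.
rewrite mem_nullspace adjmx_block // mul_block_col Rx mul0mx addr0.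
by rewrite -xE -mulmxDl -opprB addNr mul0mx col_mx0.
Qed.

Theorem theorem5p2 (R : realType) (T : finType) (e : rel T) (K S : {set T})
    (he : simple_graph e) (hKS : s_partition e K S) (hK : (2 <= #|K|)%N)
    (hC : Cker R e K S <> 0%VS) :
  Supp R e K S :&: K <> set0 <-> \dim (Cker R e K S) = 1%N.
Proof.
split=> _; last exact: Supp_clique_neq0.
apply/eqP; rewrite eqn_leq dim_Cker_le1 //= lt0n dimv_eq0.
exact/eqP.
Qed.
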